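(* For all $X,Y\in\Gamma(D)$ and $\xi,\eta\in\Gamma(D^{\bot})$, $$g(\overline{R}(X,Y)\xi,\eta)=g(\overline{A}_{\eta}Y, \overline{A}^*_{\xi}X)-g(\overline{A}_{\eta}X, \overline{A}^*_{\xi}Y)+g(\overline{R}^{L^{\bot}}(X,Y)\xi,\eta),$$ where $$\overline{R}^{L^{\bot}}(X,Y)\xi:=\overline{L}^{\bot}_X\overline{L}^{\bot}_Y\xi-\overline{L}^{\bot}_Y\overline{L}^{\bot}_X\xi-\overline{L}^{\bot}_{[X,Y]^D}\xi-\pi^{D^{\bot}}\overline{\nabla}_{[X,Y]^{D^\bot}}\xi.$$
   Context: $(M,g)$ is a smooth Riemannian manifold with Levi-Civita connection $\nabla$. $D\subseteq TM$ is a smooth subbundle (distribution) of constant rank $n$ that is non integrable, i.e. there are $X,Y\in\Gamma(D)$ with $[X,Y]\notin\Gamma(D)$. $D^\bot$ is its orthogonal complement, $\pi^D:TM\to D$ and $\pi^{D^\bot}:TM\to D^\bot$ are the orthogonal projections, $[X,Y]^D=\pi^D[X,Y]$, $[X,Y]^{D^\bot}=\pi^{D^\bot}[X,Y]$. $(M,g,\overline\nabla)$ is a statistical manifold with dual connection $\overline\nabla^*$: $\overline\nabla_XY=\nabla_XY+K(X,Y)$, $\overline\nabla^*_XY=\nabla_XY-K(X,Y)$, where $K$ is a $(1,2)$-tensor field such that $C(X,Y,Z)=g(K(X,Y),Z)$ is totally symmetric. For $X,Y\in\Gamma(D)$: $\overline B(X,Y)=\pi^{D^\bot}(\overline\nabla_XY)$,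 $\overline B^*(X,Y)=\pi^{D^\bot}(\overline\nabla^*_XY)$. For $\xi\in\Gamma(D^\bot)$ the shape operators $\overline A_\xi,\overline A^*_\xi:\Gamma(D)\to\Gamma(D)$ are defined by $g(\overline A_\xi X,Y)=g(\overline B(X,Y),\xi)$ and $g(\overline A^*_\xi X,Y)=g(\overline B^*(X,Y),\xi)$. For $X\in\Gamma(D)$, $\xi\in\Gamma(D^\bot)$: $\overline L^\bot_X\xi=\pi^{D^\bot}(\overline\nabla_X\xi)$. The curvature of $\overline\nabla$ is $\overline R(X,Y)Z=\overline\nabla_X\overline\nabla_YZ-\overline\nabla_Y\overline\nabla_XZ-\overline\nabla_{[X,Y]}Z$ for all vector fields on $M$. *)

(* Defs.v *)
From HB Require Import structures.
From mathcomp Require Import all_boot all_order all_algebra.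
From mathcomp Require Import all_classical all_reals all_analysis.
From mathcomp Require Import ring.

Set Implicit Arguments.
Unset Strict Implicit.
Unset Printing Implicit Defensive.

Import Order.TTheory GRing.Theory Num.Theory.
Import numFieldNormedType.Exports.

Local Open Scope classical_set_scope.
Local Open Scope ring_scope.

(* C^k on an open set [U], by iterated partial derivatives. *)
Fixpoint Ck (R : realType) (m k : nat) (U : set 'rV[R]_m)
    (f : 'rV[R]_m -> R) : Prop :=
  (forall x, U x -> {for x, continuous f}) /\
  if k is k'.+1 then
    forall i, (forall x, U x -> derivable f x (delta_mx 0 i)) /\
              Ck k' U (fun x => 'D_(delta_mx 0 i) f x)
  else True.

Definition Cinf (R : realType) (m : nat) (U : set 'rV[R]_m)
    (f : 'rV[R]_m -> R) : Prop := forall k, Ck k U f.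

Section CkTheory.
Variables (R : realType) (m : nat) (U : set 'rV[R]_m).
Hypothesis oU : open U.
Implicit Types f g : 'rV[R]_m -> R.

Lemma Ck_continuous k f : Ck k U f -> forall x, U x -> {for x, continuous f}.
Proof. by case: k => [|k] []. Qed.

Lemma CkS k f : Ck k.+1 U f -> Ck k U f.
Proof.
elim: k f => [|k IH] f [cf df]; first by split.
by split=> // i; have [d1 d2] := df i; split=> //; exact: IH.
Qed.

Lemma eq_Ck k f g : (forall x, U x -> f x = g x) -> Ck k U f -> Ck k U g.
Proof.
have nearU h1 h2 x : (forall y, U y -> h1 y = h2 y) -> U x ->
    \forall y \near x, h1 y = h2 y :> R.
  by move=> e Ux; apply: filterS (open_nbhs_nbhs (conj oU Ux)) => y; exact: e.
elim: k f g => [|k IH] f g fg [cf df].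
  split=> // x Ux; rewrite /prop_for /continuous_at -(fg _ Ux).
  by apply: cvg_trans (cf _ Ux);
    exact: (@near_eq_cvg _ _ _ (nbhs_filter x) _ _ (nearU _ _ _ fg Ux)).
split=> [x Ux|i].
  rewrite /prop_for /continuous_at -(fg _ Ux).
  by apply: cvg_trans (cf _ Ux);
    exact: (@near_eq_cvg _ _ _ (nbhs_filter x) _ _ (nearU _ _ _ fg Ux)).
have [d1 d2] := df i; split=> [x Ux|].
  exact: near_eq_derivable (nearU _ _ _ fg Ux) (d1 x Ux).
by apply: IH d2 => x Ux; apply: near_eq_derive; exact: nearU.
Qed.

Lemma Ck_cst k (a : R) : Ck k U (cst a).
Proof.
elim: k a => [|k IH] a; (split; first by move=> x _; exact: cst_continuous) => //.
move=> i; split=> [x _|]; first exact: derivable_cst.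
by apply: eq_Ck (IH 0) => x _; rewrite derive_cst.
Qed.

Lemma CkD k f g : Ck k U f -> Ck k U g -> Ck k U (f \+ g).
Proof.
elim: k f g => [|k IH] f g [cf df] [cg dg];
  (split; first by move=> x Ux; apply: continuousD; [exact: cf|exact: cg]) => //.
move=> i; have [f1 f2] := df i; have [g1 g2] := dg i.
split=> [x Ux|]; first by apply: derivableD; [exact: f1|exact: g1].
apply: eq_Ck (IH _ _ f2 g2) => x Ux.
by rewrite deriveD//; [exact: f1|exact: g1].
Qed.

Lemma CkM k f g : Ck k U f -> Ck k U g -> Ck k U (f \* g).
Proof.
elim: k f g => [|k IH] f g Hf Hg; have cf := Ck_continuous Hf;
  have cg := Ck_continuous Hg;
  (split; first by move=> x Ux; apply: continuousM; [exact: cf|exact: cg]) => //.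
have f0 := CkS Hf; have g0 := CkS Hg; case: Hf => _ df; case: Hg => _ dg.
move=> i; have [f1 f2] := df i; have [g1 g2] := dg i.
split=> [x Ux|]; first by apply: derivableM; [exact: f1|exact: g1].
apply: eq_Ck (CkD (IH _ _ f0 g2) (IH _ _ g0 f2)) => x Ux /=.
by rewrite deriveM//; [exact: f1|exact: g1].
Qed.

End CkTheory.

(* [chart_map] and [chart_inv] are total functions, meaningful only on
   [chart_dom] and [chart_cod] respectively. *)
Record chart (R : realType) (m : nat) (M : topologicalType) := Chart {
  chart_dom : set M;
  chart_map :> M -> 'rV[R]_m;
  chart_inv : 'rV[R]_m -> M;
  chart_cod := chart_map @` chart_dom;
  chart_dom_open : open chart_dom;
  chart_cod_open : open chart_cod;
  chart_mapK : forall x, chart_dom x -> chart_inv (chart_map x) = x;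
  chart_map_continuous : forall x, chart_dom x -> {for x, continuous chart_map};
  chart_inv_continuous : forall y, chart_cod y -> {for y, continuous chart_inv}
}.

(* [atlas] need not be maximal: it has the same smooth functions as the maximal
   atlas it generates. *)
Record manifold (R : realType) (m : nat) := Manifold {
  manifold_space :> topologicalType;
  manifold_hausdorff : hausdorff_space manifold_space;
  manifold_second_countable : @second_countable manifold_space;
  atlas : set (chart R m manifold_space);
  atlas_cover : forall p, exists2 c, atlas c & chart_dom c p;
  atlas_smooth : forall c c', atlas c -> atlas c' -> forall j,
    Cinf (c @` (chart_dom c `&` chart_dom c'))
         (fun x => c' (chart_inv c x) 0 j)
}.

(* [U] is meant to be open. *)
Definition smooth_on (R : realType) (m : nat) (M : manifold R m) (U : set M)
    (f : M -> R) : Prop :=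
  forall c, @atlas R m M c ->
    Cinf (c @` (chart_dom c `&` U)) (f \o chart_inv c).

Section SmoothFunctions.
Variables (R : realType) (m : nat) (M : manifold R m).
Implicit Types f g : M -> R^o.

Lemma smooth_cst (a : R) : smooth_on [set: M] (cst a).
Proof.
by move=> c _ k; rewrite setIT; apply: Ck_cst; exact: chart_cod_open.
Qed.

Lemma smoothD f g : smooth_on setT f -> smooth_on setT g ->
  smooth_on [set: M] (f \+ g).
Proof.
move=> sf sg c Ac k; have := sf c Ac k; have := sg c Ac k; rewrite setIT => Hg Hf.
exact: (CkD (@chart_cod_open _ _ _ c) Hf Hg).
Qed.

Lemma smoothM f g : smooth_on setT f -> smooth_on setT g ->
  smooth_on [set: M] (f \* g).
Proof.
move=> sf sg c Ac k; have := sf c Ac k; have := sg c Ac k; rewrite setIT => Hg Hf.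
exact: (CkM (@chart_cod_open _ _ _ c) Hf Hg).
Qed.

Definition smooth : {pred M -> R^o} := fun f => `[< smooth_on setT f >].

Lemma smooth_subring_closed : subring_closed smooth.
Proof.
split=> [|f g|f g]; first exact/asboolP/smooth_cst.
- move=> /asboolP sf /asboolP sg; apply/asboolP.
  have -> : f - g = f \+ (cst (-1) \* g).
    by apply/funext => x; rewrite /= /cst mulN1r.
  by apply: smoothD => //; apply: smoothM => //; exact: smooth_cst.
- by move=> /asboolP sf /asboolP sg; apply/asboolP; exact: smoothM.
Qed.

Lemma smooth_scaler_closed : GRing.scaler_closed smooth.
Proof.
move=> a f /asboolP sf; apply/asboolP.
exact: (smoothM (smooth_cst a) sf).
Qed.

HB.instance Definition _ := GRing.isSubringClosed.Build _ smooth
  smooth_subring_closed.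
HB.instance Definition _ := GRing.isScaleClosed.Build R (M -> R^o) smooth
  smooth_scaler_closed.


Record csmooth := CSmooth {
  csmooth_fun :> M -> R^o;
  csmoothP : csmooth_fun \in smooth
}.
HB.instance Definition _ := [isSub for csmooth_fun].
HB.instance Definition _ := [Choice of csmooth by <:].
HB.instance Definition _ :=
  GRing.SubChoice_isSubComPzRing.Build _ _ csmooth smooth_subring_closed.
HB.instance Definition _ := [SubZmodule_isSubLmodule of csmooth by <:].

Definition mk_csmooth f (sf : smooth_on setT f) : csmooth :=
  CSmooth (asboolT sf).

End SmoothFunctions.

(* A tangent vector at [p] is a derivation at [p] of the algebra of smooth
   functions on [M]. *)

Section Tangent.
Variables (R : realType) (m : nat) (M : manifold R m) (p : M).

Definition derivation_at : {pred csmooth M -> R^o} := fun v =>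
  `[< linear v /\ forall f h : csmooth M, v (f * h) = f p * v h + h p * v f >].

Lemma derivation_at_submod_closed : submod_closed derivation_at.
Proof.
have E0 f : (0 : csmooth M -> R^o) f = 0 by [].
have ED a (u v : csmooth M -> R^o) f : (a *: u + v) f = a *: u f + v f by [].
split=> [|a u v /asboolP[lu du] /asboolP[lv dv]]; apply/asboolP; split.
- by move=> b f h; rewrite !E0 scaler0 addr0.
- by move=> f h; rewrite !E0 !mulr0 addr0.
- move=> b f h; rewrite !ED lu lv !scalerDr !scalerA (mulrC b a).
  by rewrite -!addrA; congr (_ + _); rewrite addrCA.
- move=> f h; rewrite !ED du dv !scalerDr /GRing.scale /= !mulrDr.
  by rewrite !(mulrCA a) -!addrA; congr (_ + _); rewrite addrCA.
Qed.

HB.instance Definition _ := GRing.isSubmodClosed.Build R (csmooth M -> R^o)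
  derivation_at derivation_at_submod_closed.

Record tangent := Tangent {
  tangent_fun :> csmooth M -> R^o;
  tangentP : tangent_fun \in derivation_at
}.
HB.instance Definition _ := [isSub for tangent_fun].
HB.instance Definition _ := [Choice of tangent by <:].
HB.instance Definition _ := [SubChoice_isSubLmodule of tangent by <:].

End Tangent.

(* [X] restricted to the open set [U] is a smooth vector field on [U]; such
   fields are encoded as total sections, with arbitrary values off [U]. *)
Definition smooth_field_on (R : realType) (m : nat) (M : manifold R m)
    (U : set M) (X : forall p : M, tangent p) : Prop :=
  forall f : csmooth M, smooth_on U (fun p => X p f).

Section VectorFields.
Variables (R : realType) (m : nat) (M : manifold R m).

Record vfield := VField {
  vfield_fun :> forall p : M, tangent p;
  vfieldP : smooth_field_on setT vfield_fun
}.
Implicit Types (X Y Z : vfield) (f h : csmooth M).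

Lemma vfield_eq X Y : (forall p, X p = Y p) -> X = Y.
Proof.
case: X Y => [X sX] [Y sY] /= XY; have E : X = Y
    by apply: functional_extensionality_dep.
by subst Y; congr VField; exact: Prop_irrelevance.
Qed.

(* The function X f : p |-> X_p f. *)
Definition vapp X f : csmooth M := mk_csmooth (vfieldP X f).

Lemma vfield0_smooth : smooth_field_on [set: M] (fun p => 0).
Proof. by move=> f; exact: smooth_cst. Qed.

Lemma vfieldD_smooth X Y : smooth_field_on [set: M] (fun p => X p + Y p).
Proof. by move=> f; exact: smoothD (vfieldP X f) (vfieldP Y f). Qed.

Lemma vfieldZ_smooth f X : smooth_field_on [set: M] (fun p => f p *: X p).
Proof.
by move=> h; exact: smoothM (asboolW (csmoothP f)) (vfieldP X h).
Qed.

Lemma vfieldN_smooth X : smooth_field_on [set: M] (fun p => - X p).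
Proof.
move=> f; rewrite (_ : (fun _ => _) = fun p => (cst (-1) \* (fun p => X p f)) p).
  by apply: smoothM; [exact: smooth_cst|exact: vfieldP].
by apply/funext => p; rewrite /= /cst mulN1r.
Qed.

HB.instance Definition _ := gen_eqMixin vfield.
HB.instance Definition _ := gen_choiceMixin vfield.

Definition vfield0 := VField vfield0_smooth.
Definition vfieldD X Y := VField (vfieldD_smooth X Y).
Definition vfieldN X := VField (vfieldN_smooth X).
Definition vfieldZ f X := VField (vfieldZ_smooth f X).

Lemma vfieldDA : associative vfieldD.
Proof. by move=> X Y Z; apply: vfield_eq => p /=; rewrite addrA. Qed.
Lemma vfieldDC : commutative vfieldD.
Proof. by move=> X Y; apply: vfield_eq => p /=; rewrite addrC. Qed.
Lemma vfield0D : left_id vfield0 vfieldD.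
Proof. by move=> X; apply: vfield_eq => p /=; rewrite add0r. Qed.
Lemma vfieldND : left_inverse vfield0 vfieldN vfieldD.
Proof. by move=> X; apply: vfield_eq => p /=; rewrite addNr. Qed.

HB.instance Definition _ :=
  GRing.isZmodule.Build vfield vfieldDA vfieldDC vfield0D vfieldND.

Lemma vfieldZA f h X : vfieldZ f (vfieldZ h X) = vfieldZ (f * h) X.
Proof. by apply: vfield_eq => p /=; rewrite scalerA. Qed.
Lemma vfieldZ1 : left_id 1 vfieldZ.
Proof. by move=> X; apply: vfield_eq => p /=; rewrite scale1r. Qed.
Lemma vfieldZDr : right_distributive vfieldZ +%R.
Proof. by move=> f X Y; apply: vfield_eq => p /=; rewrite scalerDr. Qed.
Lemma vfieldZDl X : {morph vfieldZ^~ X : f h / f + h}.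
Proof. by move=> f h; apply: vfield_eq => p /=; rewrite scalerDl. Qed.

HB.instance Definition _ := GRing.Zmodule_isLmodule.Build (csmooth M) vfield
  vfieldZA vfieldZ1 vfieldZDr vfieldZDl.

(* Lie bracket: [X, Y]_p f = X_p (Y f) - Y_p (X f). *)
Definition bracket_fun X Y (p : M) : csmooth M -> R^o :=
  fun f => X p (vapp Y f) - Y p (vapp X f).

Let bracket_aux (a b a1 a2 b1 b2 xa xb ya yb : R) :
  a * b1 + yb * xa + (b * a1 + ya * xb) -
    (a * b2 + xb * ya + (b * a2 + xa * yb)) = a * (b1 - b2) + b * (a1 - a2).
Proof. by ring. Qed.

Lemma bracket_derivation X Y p : bracket_fun X Y p \in derivation_at p.
Proof.
have lin (Z : vfield) q a f h : Z q (a *: f + h) = a *: Z q f + Z q h.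
  by have /asboolP[l _] := tangentP (Z q); exact: l.
have der (Z : vfield) q f h : Z q (f * h) = f q * Z q h + h q * Z q f.
  by have /asboolP[_ d] := tangentP (Z q); exact: d.
have vlin Z a f h : vapp Z (a *: f + h) = a *: vapp Z f + vapp Z h.
  by apply/val_inj/funext => q; exact: lin.
have vder Z f h : vapp Z (f * h) = 1 *: (f * vapp Z h) + h * vapp Z f.
  by rewrite scale1r; apply/val_inj/funext => q; exact: der.
apply/asboolP; split => [a f h|f h]; rewrite /bracket_fun.
  by rewrite !vlin !lin scalerBr opprD !addrA; congr (_ + _); rewrite addrAC.
rewrite !vder !lin !der !scale1r; exact: bracket_aux.
Qed.

Definition bracket_at X Y p : tangent p := Tangent (bracket_derivation X Y p).

Lemma bracket_smooth X Y : smooth_field_on setT (bracket_at X Y).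
Proof.
move=> f; have sX := vfieldP X (vapp Y f); have sY := vfieldP Y (vapp X f).
rewrite (_ : (fun p => _) = (fun p => X p (vapp Y f)) \+
    (cst (-1) \* (fun p => Y p (vapp X f)))).
  by apply: smoothD => //; apply: smoothM => //; exact: smooth_cst.
by apply/funext => p; rewrite /= /cst mulN1r.
Qed.

Definition bracket X Y : vfield := VField (bracket_smooth X Y).

End VectorFields.

Section Tensors.
Variables (R : realType) (m : nat) (M : manifold R m).

Record riemannian_metric := RiemannianMetric {
  riemannian_form :> forall p : M, tangent p -> tangent p -> R;
  riemannian_linear : forall (p : M) (a : R) (u v w : tangent p),
    riemannian_form (a *: u + v) w =
      a * riemannian_form u w + riemannian_form v w;
  riemannian_sym : forall (p : M) (u v : tangent p),
    riemannian_form u v = riemannian_form v u;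
  riemannian_pos : forall (p : M) (u : tangent p),
    u != 0 -> 0 < riemannian_form u u;
  riemannian_smooth : forall X Y : vfield M,
    smooth_on setT (fun p => riemannian_form (X p) (Y p))
}.

Arguments riemannian_form g p u v : rename.

Definition mapp (g : riemannian_metric) (X Y : vfield M) : csmooth M :=
  mk_csmooth (riemannian_smooth g X Y).

(* Smooth bundle endomorphisms of TM. *)
Record endo := Endo {
  endo_fun :> forall p : M, tangent p -> tangent p;
  endo_linear : forall (p : M) (a : R) (u v : tangent p),
    endo_fun (a *: u + v) = a *: endo_fun u + endo_fun v;
  endo_smooth : forall X : vfield M,
    smooth_field_on setT (fun p => endo_fun (X p))
}.

Arguments endo_fun P p v : rename.

Definition eapp (P : endo) (X : vfield M) : vfield M :=
  VField (endo_smooth P X).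

Record tensor12 := Tensor12 {
  tensor_fun :> forall p : M, tangent p -> tangent p -> tangent p;
  tensor_linearl : forall (p : M) (a : R) (u v w : tangent p),
    tensor_fun (a *: u + v) w = a *: tensor_fun u w + tensor_fun v w;
  tensor_linearr : forall (p : M) (a : R) (u v w : tangent p),
    tensor_fun w (a *: u + v) = a *: tensor_fun w u + tensor_fun w v;
  tensor_smooth : forall X Y : vfield M,
    smooth_field_on setT (fun p => tensor_fun (X p) (Y p))
}.

Arguments tensor_fun K p u v : rename.

Definition tapp (K : tensor12) (X Y : vfield M) : vfield M :=
  VField (tensor_smooth K X Y).

(* C(X,Y,Z) = g(K(X,Y),Z) is totally symmetric; the two transpositions
   generate the symmetric group. *)
Definition cubic_symmetric (g : riemannian_metric) (K : tensor12) : Prop :=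
  forall X Y Z : vfield M,
    mapp g (tapp K X Y) Z = mapp g (tapp K Y X) Z /\
    mapp g (tapp K X Y) Z = mapp g (tapp K X Z) Y.

End Tensors.

Section Connections.
Variables (R : realType) (m : nat) (M : manifold R m).
Implicit Types (X Y Z : vfield M) (f : csmooth M).

(* R-linearity in [Y] follows from additivity and the Leibniz rule. *)
Definition connection (nabla : vfield M -> vfield M -> vfield M) : Prop :=
  [/\ forall f X Y Z, nabla (f *: X + Y) Z = f *: nabla X Z + nabla Y Z,
      forall X Y Z, nabla X (Y + Z) = nabla X Y + nabla X Z &
      forall f X Y, nabla X (f *: Y) = vapp X f *: Y + f *: nabla X Y].

Definition levi_civita (g : riemannian_metric M) nabla : Prop :=
  [/\ connection nabla,
      forall X Y, nabla X Y - nabla Y X = bracket X Y &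
      forall X Y Z,
        vapp X (mapp g Y Z) = mapp g (nabla X Y) Z + mapp g Y (nabla X Z)].

Definition stat_conn nabla (K : tensor12 M) X Y : vfield M :=
  nabla X Y + tapp K X Y.

Definition dual_conn nabla (K : tensor12 M) X Y : vfield M :=
  nabla X Y - tapp K X Y.

Definition curvature (nabla : vfield M -> vfield M -> vfield M)
    X Y Z : vfield M :=
  nabla X (nabla Y Z) - nabla Y (nabla X Z) - nabla (bracket X Y) Z.

End Connections.

Section Distributions.
Variables (R : realType) (m : nat) (M : manifold R m).

(* [X] is a basis of the subset [V] of the tangent space (which is therefore a
   linear subspace of dimension [n]). *)
Definition basis_of_fiber (p : M) (n : nat) (V : set (tangent p))
    (X : 'I_n -> tangent p) : Prop :=
  (forall a : 'I_n -> R, \sum_i a i *: X i = 0 -> forall i, a i = 0) /\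
  (forall v, V v <-> exists a : 'I_n -> R, v = \sum_i a i *: X i).

(* Smooth subbundles of rank [n] of TM: spanned by a smooth frame near every
   point. *)
Record tangent_distribution (n : nat) := Distribution {
  fiber :> forall p : M, set (tangent p);
  local_frame : forall p : M,
    exists (U : set M) (X : 'I_n -> forall q : M, tangent q),
      [/\ open_nbhs p U,
          forall i, smooth_field_on U (X i) &
          forall q, U q -> basis_of_fiber (@fiber q) (fun i => X i q)]
}.

Arguments fiber {n} D p v : rename.

(* [is_section E X] means X \in Gamma(E). *)
Definition is_section (E : forall p : M, set (tangent p)) (X : vfield M) :
  Prop := forall p, E p (X p).

Definition non_integrable (E : forall p : M, set (tangent p)) : Prop :=
  exists X Y,
    [/\ is_section E X, is_section E Y & ~ is_section E (bracket X Y)].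

Definition orthogonal_complement (g : riemannian_metric M)
    (E : forall p : M, set (tangent p)) : forall p : M, set (tangent p) :=
  fun p => [set v | forall w, E p w -> g p v w = 0].

#[local] Arguments orthogonal_complement g E p v : clear implicits.

(* This determines [P] uniquely. *)
Definition orthogonal_projection (g : riemannian_metric M)
    (E : forall p : M, set (tangent p)) (P : endo M) : Prop :=
  forall (p : M) (v : tangent p),
    E p (P p v) /\ orthogonal_complement g E p (v - P p v).

End Distributions.

Arguments orthogonal_complement {R m M} g E p v.

(* Below, [P] and [Q] stand for the orthogonal projections onto a distribution
   and onto its orthogonal complement. *)

Section DistributionGeometry.
Variables (R : realType) (m : nat) (M : manifold R m).
Implicit Types (X Y Z xi : vfield M).
Implicit Types nabla : vfield M -> vfield M -> vfield M.

Definition second_form (Q : endo M) nabla X Y := eapp Q (nabla X Y).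

(* A xi maps \Gamma(E) to itself, for xi in \Gamma(E^\bot); its values on other
   arguments are irrelevant. *)
Definition shape_operator (g : riemannian_metric M)
    (E : forall p : M, set (tangent p))
    (B A : vfield M -> vfield M -> vfield M) : Prop :=
  forall xi X, is_section (orthogonal_complement g E) xi -> is_section E X ->
    is_section E (A xi X) /\
    forall Y, is_section E Y -> mapp g (A xi X) Y = mapp g (B X Y) xi.

Definition normal_conn (Q : endo M) nabla X xi := eapp Q (nabla X xi).

Definition normal_curvature (P Q : endo M) nabla X Y xi : vfield M :=
  let L := normal_conn Q nabla in
  L X (L Y xi) - L Y (L X xi) - L (eapp P (bracket X Y)) xi
    - eapp Q (nabla (eapp Q (bracket X Y)) xi).

End DistributionGeometry.

(* Main.v *)
Require Import Defs.
From mathcomp Require Import all_boot all_order all_algebra all_reals.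
From mathcomp Require Import boolp classical_sets topology.

Set Implicit Arguments.
Unset Strict Implicit.
Unset Printing Implicit Defensive.

Import GRing.Theory.
Local Open Scope ring_scope.

(** The Ricci equation compares the normal part of the curvature with the
    curvature of the normal connection [L]. Split every field into its [D] part
    and its normal part, which is legitimate because the two projections add up
    to the identity ([projectionsD]). In the second derivative
    [nabla_X nabla_Y xi], the normal part of [nabla_Y xi] contributes
    [L_X L_Y xi]. The part [W] of [nabla_Y xi] tangent to [D] contributes
    the normal component of [nabla_X W], that is, the second fundamental form
    [B(X, W)], and hence

      g(nabla_X W, eta) = g(A_eta X, W) = g(A_eta X, nabla_Y xi).

    The statistical connection and its dual are conjugate with respect to [g]
    ([stat_conn_dual]), so differentiating [g(xi, Z) = 0] for [Z] in [D] gives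
    [g(nabla_Y xi, Z) = - g(A'_xi Y, Z)] ([weingarten]); with [Z = A_eta X] this
    turns the contribution of [W] into [- g(A_eta X, A'_xi Y)]
    ([normal_second_derivative]). Antisymmetrizing in [X] and [Y] yields the two
    shape operator terms. Finally [nabla_[X,Y] xi] splits along the two
    components of the bracket, which need both be kept since [D] is not
    integrable. *)

Section MetricAlgebra.
Variables (R : realType) (m : nat) (M : manifold R m).
Variable g : riemannian_metric M.
Implicit Types (X Y Z : vfield M) (f h : csmooth M).

Lemma csmooth_eq f h : (forall p, f p = h p) -> f = h.
Proof. by move=> fh; apply/val_inj/funext. Qed.

Lemma vapp0 X : vapp X 0 = 0.
Proof.
apply: csmooth_eq => p /=; have /asboolP[_ leibniz] := tangentP (X p).
have := leibniz 0 0.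
by rewrite mul0r => ->; rewrite (_ : (0 : csmooth M) p = 0)// mul0r addr0.
Qed.

Lemma formDl p (u v w : tangent p) : g p (u + v) w = g p u w + g p v w.
Proof. by rewrite -[u in LHS]scale1r riemannian_linear mul1r. Qed.

Lemma form0l p (w : tangent p) : g p 0 w = 0.
Proof. by apply: (addrI (g p 0 w)); rewrite -formDl !addr0. Qed.

Lemma formNl p (u w : tangent p) : g p (- u) w = - g p u w.
Proof. by apply: (addrI (g p u w)); rewrite -formDl !subrr form0l. Qed.

Lemma formBl p (u v w : tangent p) : g p (u - v) w = g p u w - g p v w.
Proof. by rewrite formDl formNl. Qed.

Lemma form_eq0 p (u : tangent p) : g p u u = 0 -> u = 0.
Proof.
move=> guu; apply/eqP; apply: contraPT guu => /(riemannian_pos g) + guu0.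
by rewrite guu0 Order.POrderTheory.ltxx.
Qed.

Lemma mappC X Y : mapp g X Y = mapp g Y X.
Proof. by apply: csmooth_eq => p; exact: riemannian_sym. Qed.

Lemma mappDl X Y Z : mapp g (X + Y) Z = mapp g X Z + mapp g Y Z.
Proof. by apply: csmooth_eq => p; exact: formDl. Qed.

Lemma mappBl X Y Z : mapp g (X - Y) Z = mapp g X Z - mapp g Y Z.
Proof. by apply: csmooth_eq => p; exact: formBl. Qed.

Lemma mappBr X Y Z : mapp g X (Y - Z) = mapp g X Y - mapp g X Z.
Proof. by rewrite !(mappC X) mappBl. Qed.

End MetricAlgebra.

Section StatisticalConnection.
Variables (R : realType) (m : nat) (M : manifold R m).
Variables (g : riemannian_metric M) (nabla : vfield M -> vfield M -> vfield M).
Variable K : tensor12 M.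
Implicit Types X Y Z : vfield M.

Lemma tappDl X Y Z : tapp K (X + Y) Z = tapp K X Z + tapp K Y Z.
Proof.
apply: vfield_eq => p /=.
by rewrite -[X p in LHS]scale1r tensor_linearl scale1r.
Qed.

Lemma tappDr X Y Z : tapp K X (Y + Z) = tapp K X Y + tapp K X Z.
Proof.
apply: vfield_eq => p /=.
by rewrite -[Y p in LHS]scale1r tensor_linearr scale1r.
Qed.

Lemma stat_connDl X Y Z : connection nabla ->
  stat_conn nabla K (X + Y) Z = stat_conn nabla K X Z + stat_conn nabla K Y Z.
Proof.
case=> lin _ _; have := lin 1 X Y Z; rewrite !scale1r /stat_conn => ->.
by rewrite tappDl addrACA.
Qed.

Lemma stat_connDr X Y Z : connection nabla ->
  stat_conn nabla K X (Y + Z) = stat_conn nabla K X Y + stat_conn nabla K X Z.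
Proof. by case=> _ add _; rewrite /stat_conn add tappDr addrACA. Qed.

(** Total symmetry makes [g(K(X,Y),Z)] symmetric in [Y] and [Z], so the two
    contributions of [K], which enter with opposite signs, cancel in the
    product rule for the metric. *)
Lemma stat_conn_dual X Y Z : levi_civita g nabla -> cubic_symmetric g K ->
  vapp X (mapp g Y Z) =
    mapp g (stat_conn nabla K X Y) Z + mapp g Y (dual_conn nabla K X Z).
Proof.
case=> _ _ metric sym; rewrite metric /stat_conn /dual_conn mappDl mappBr.
have [_ ->] := sym X Y Z; rewrite (mappC g Y (tapp K X Z)).
by rewrite addrACA subrr addr0.
Qed.

End StatisticalConnection.

Section Projections.
Variables (R : realType) (m : nat) (M : manifold R m).
Variable g : riemannian_metric M.
Variable E : forall p : M, set (tangent p).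
Implicit Types X Y Z : vfield M.

Local Notation normal := (orthogonal_complement g E).

Lemma mapp_orthogonal X Y : is_section E X -> is_section normal Y ->
  mapp g Y X = 0.
Proof. by move=> EX NY; apply: csmooth_eq => p; exact: NY. Qed.

Lemma mapp_projl (P : endo M) X Y : orthogonal_projection g E P ->
  is_section E Y -> mapp g (eapp P X) Y = mapp g X Y.
Proof.
move=> projP EY; apply: csmooth_eq => p /=.
have [_ /(_ _ (EY p)) /eqP] := projP p (X p).
by rewrite formBl subr_eq0 => /eqP.
Qed.

Lemma proj_section (P : endo M) X : orthogonal_projection g E P ->
  is_section E (eapp P X).
Proof. by move=> projP p; have [] := projP p (X p). Qed.

(** The remainder [v - P v - Q v] lies in the normal space and is orthogonal to
    it, so it vanishes by definiteness. *)
Lemma projectionsD (P Q : endo M) X :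
  orthogonal_projection g E P -> orthogonal_projection g normal Q ->
  eapp P X + eapp Q X = X.
Proof.
move=> projP projQ; apply: vfield_eq => p /=; set v := X p.
have [EP NP] := projP p v; have [NQ NNQ] := projQ p v.
have NW : normal p (v - P p v - Q p v).
  by move=> w Ew; rewrite formBl NP// NQ// subr0.
apply/esym/eqP; rewrite -subr_eq0 opprD addrA; apply/eqP/(@form_eq0 _ _ _ g).
rewrite {1}addrAC formBl NNQ// sub0r riemannian_sym.
by rewrite NW// oppr0.
Qed.

End Projections.

Section SecondDerivative.
Variables (R : realType) (m : nat) (M : manifold R m).
Variables (g : riemannian_metric M) (nabla : vfield M -> vfield M -> vfield M).
Variables (E : forall p : M, set (tangent p)) (K : tensor12 M) (P Q : endo M).
Variables A A' : vfield M -> vfield M -> vfield M.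
Implicit Types X Y Z xi eta : vfield M.

Local Notation normal := (orthogonal_complement g E).
Local Notation nb := (stat_conn nabla K).
Local Notation nb' := (dual_conn nabla K).

Hypothesis nabla_LC : levi_civita g nabla.
Hypothesis K_sym : cubic_symmetric g K.
Hypothesis Q_proj : orthogonal_projection g normal Q.
Hypothesis A'_shape : shape_operator g E (second_form Q nb') A'.

(** The Weingarten formula: the tangential part of the derivative of a normal
    field is minus the shape operator of the dual connection, since the
    derivative of [g(xi, Z) = 0] exchanges the connection with its dual. *)
Lemma weingarten X Z xi :
  is_section E X -> is_section E Z -> is_section normal xi ->
  mapp g (nb X xi) Z = - mapp g (A' xi X) Z.
Proof.
move=> EX EZ Nxi; have [_ ->//] := A'_shape Nxi EX.
rewrite /second_form (mapp_projl _ Q_proj)// (mappC g (nb' _ _)).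
apply/eqP; rewrite -addr_eq0 -stat_conn_dual//.
by rewrite (mapp_orthogonal EZ Nxi) vapp0.
Qed.

Hypothesis P_proj : orthogonal_projection g E P.
Hypothesis A_shape : shape_operator g E (second_form Q nb) A.

(** Only the tangential part of [nb Y xi] separates the second derivative from
    its normal version: it enters through the second fundamental form, that is
    through [A], and is itself given by [A'] through Weingarten. *)
Lemma normal_second_derivative X Y xi eta :
  is_section E X -> is_section E Y ->
  is_section normal xi -> is_section normal eta ->
  mapp g (nb X (nb Y xi)) eta =
    mapp g (normal_conn Q nb X (normal_conn Q nb Y xi)) eta
    - mapp g (A eta X) (A' xi Y).
Proof.
move=> EX EY Nxi Neta; have [conn _ _] := nabla_LC.
have EW := proj_section (nb Y xi) P_proj.
have [EA AE] := A_shape Neta EX.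
rewrite /normal_conn (mapp_projl _ Q_proj)//.
rewrite -{1}(projectionsD (nb Y xi) P_proj Q_proj) stat_connDr// mappDl addrC.
congr (_ + _).
(* Moving [A eta X], a section of [E], across the product absorbs the
   projection [P], so Weingarten applies to the whole of [nb Y xi]. *)
rewrite -(mapp_projl _ Q_proj)// -[LHS]AE// mappC.
by rewrite (mapp_projl _ P_proj)// weingarten// mappC.
Qed.

End SecondDerivative.

Theorem theorem4p3 (R : realType) (m n : nat) (M : manifold R m)
    (g : riemannian_metric M) (nabla : vfield M -> vfield M -> vfield M)
    (nabla_LC : levi_civita g nabla)
    (D : tangent_distribution M n) (D_nonint : non_integrable D)
    (K : tensor12 M) (K_sym : cubic_symmetric g K)
    (piD piN : endo M)
    (piD_proj : orthogonal_projection g D piD)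
    (piN_proj : orthogonal_projection g (orthogonal_complement g D) piN)
    (A A' : vfield M -> vfield M -> vfield M)
    (A_shape : shape_operator g D (second_form piN (stat_conn nabla K)) A)
    (A'_shape : shape_operator g D (second_form piN (dual_conn nabla K)) A')
    (X Y xi eta : vfield M)
    (X_D : is_section D X) (Y_D : is_section D Y)
    (xi_N : is_section (orthogonal_complement g D) xi)
    (eta_N : is_section (orthogonal_complement g D) eta) :
  mapp g (curvature (stat_conn nabla K) X Y xi) eta =
    mapp g (A eta Y) (A' xi X) - mapp g (A eta X) (A' xi Y)
    + mapp g (normal_curvature piD piN (stat_conn nabla K) X Y xi) eta.
Proof.
have [conn _ _] := nabla_LC.
have second_derivative := normal_second_derivative nabla_LC K_sym piN_proj
  A'_shape piD_proj A_shape.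
rewrite /curvature /normal_curvature !mappBl !second_derivative//.
rewrite -{1}(projectionsD (bracket X Y) piD_proj piN_proj) stat_connDl//.
rewrite mappDl /normal_conn !(mapp_projl _ piN_proj)//.
rewrite !opprD !opprK !addrA; congr (_ + _ + _).
rewrite addrAC -[RHS]addrA [RHS]addrC -!addrA; congr (_ + _).
by rewrite [RHS]addrC addrA (addrC (mapp g (A eta Y) _)).
Qed.
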